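(* Let $a,b\in\mathbb{R}\setminus\{0\}$ and, for $n\in\mathbb{N}_0$, let $$Q(x,n)=\begin{pmatrix}H_n(x-b)& aH_{n+1}(x)-axH_n(x-b)\\ -anH_{n-1}(x-b)& 2e^{b^2}H_n(x)+a^2nxH_{n-1}(x-b)\end{pmatrix}.$$ Then these matrix polynomials, which are orthogonal with respect to $W(x)=e^{-x^{2}}\begin{pmatrix} e^{2bx}+a^{2}x^{2} & ax\\ ax & 1\end{pmatrix}$ on $\mathbb{R}$, satisfy the three-term recursion relation $$Q(x,n)\,x=\widetilde A_nQ(x,n+1)+\widetilde B_nQ(x,n)+\widetilde C_nQ(x,n-1),\qquad n\in\mathbb{N}_0,$$ where $$\widetilde A_n=\begin{pmatrix}1&-\frac{ab}{2e^{b^2}+(n+1)a^2}\\0&\frac{2e^{b^2}+na^2}{2e^{b^2}+(n+1)a^2}\end{pmatrix},\qquad \widetilde B_n=\begin{pmatrix}\frac{2e^{b^2}b}{2e^{b^2}+(n+1)a^2}&\frac{a}{2(2e^{b^2}+na^2)}\\ \frac{2e^{b^2}a}{2e^{b^2}+(n+1)a^2}&\frac{na^2b}{2e^{b^2}+na^2}\end{pmatrix},$$ $$\widetilde C_n=\begin{pmatrix}\frac n2\,\frac{(n+1)a^2+2e^{b^2}}{2e^{b^2}+na^2}&0\\ -\frac{2nab\,e^{b^2}}{2e^{b^2}+na^2}&\frac n2\end{pmatrix}.$$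
   Context: $H_n(x)=\frac{(-1)^n}{2^n}(e^{-x^2})^{(n)}e^{x^2}$ is the $n$-th monic Hermite polynomial; terms containing $nH_{n-1}$ are zero for $n=0$, and $Q(x,-1)=0$ (note $\widetilde C_0=0$). *)

(* Defs.v *)
From HB Require Import structures.
From mathcomp Require Import all_boot all_order all_algebra.
From mathcomp Require Import all_classical all_reals all_analysis.
Set Implicit Arguments.
Unset Strict Implicit.
Unset Printing Implicit Defensive.
Import Order.TTheory GRing.Theory Num.Theory.
Import numFieldNormedType.Exports.
Local Open Scope ring_scope.

Definition mx2 (R : Type) (p q r s : R) : 'M[R]_2 :=
  \matrix_(i < 2, j < 2)
    if i == ord0 then (if j == ord0 then p else q)
    else (if j == ord0 then r else s).

Definition hermite (R : realType) (n : nat) (x : R) : R :=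
  (-1) ^+ n / 2 ^+ n * derive1n n (fun t : R => expR (- t ^+ 2)) x
  * expR (x ^+ 2).

Definition mxpoly_nonsing_lead (R : realType) (N n : nat) (P : R -> 'M[R]_N) :=
  exists c : 'I_n.+1 -> 'M[R]_N,
    c ord_max \in unitmx /\
    forall x, P x = \sum_(k < n.+1) x ^+ k *: c k.

(* All the matrices are real, so the adjoint P^* of the inner product
   <P, Q> = \int P W Q^* is the transpose. *)
Definition ip_integrand (R : realType) (N : nat) (W P Q : R -> 'M[R]_N)
  (i j : 'I_N) (x : R) : R := (P x *m W x *m (Q x)^T) i j.

Definition mxip (R : realType) (N : nat) (W P Q : R -> 'M[R]_N) : 'M[R]_N :=
  \matrix_(i < N, j < N)
    Rintegral (@lebesgue_measure R) setT (ip_integrand W P Q i j).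

(* Integrability is required separately because Rintegral is total. *)
Definition mx_orthogonal (R : realType) (N : nat) (W : R -> 'M[R]_N)
  (P : nat -> R -> 'M[R]_N) : Prop :=
  [/\ forall n, mxpoly_nonsing_lead n (P n),
      forall m n i j, (@lebesgue_measure R).-integrable setT
                        (EFin \o ip_integrand W (P m) (P n) i j)
    & forall m n, m <> n -> mxip W (P m) (P n) = 0].

Section HermiteExample.
Variables (R : realType) (a b : R).

Definition Wt (x : R) : 'M[R]_2 :=
  expR (- x ^+ 2) *:
  mx2 (expR (2 * b * x) + a ^+ 2 * x ^+ 2) (a * x)
      (a * x)                              1.

(* For n = 0 the terms in hermite n.-1 are multiplied by 0%:R. *)
Definition Q (n : nat) (x : R) : 'M[R]_2 :=
  mx2 (hermite n (x - b))
      (a * hermite n.+1 x - a * x * hermite n (x - b))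
      (- (a * n%:R * hermite n.-1 (x - b)))
      (2 * expR (b ^+ 2) * hermite n x
       + a ^+ 2 * n%:R * x * hermite n.-1 (x - b)).

(* Q(x, n - 1), with Q(x, -1) = 0. *)
Definition Qprev (n : nat) (x : R) : 'M[R]_2 :=
  if n is m.+1 then Q m x else 0.

Definition At (n : nat) : 'M[R]_2 :=
  mx2 1 (- (a * b / (2 * expR (b ^+ 2) + n.+1%:R * a ^+ 2)))
      0 ((2 * expR (b ^+ 2) + n%:R * a ^+ 2)
         / (2 * expR (b ^+ 2) + n.+1%:R * a ^+ 2)).

Definition Bt (n : nat) : 'M[R]_2 :=
  mx2 (2 * expR (b ^+ 2) * b / (2 * expR (b ^+ 2) + n.+1%:R * a ^+ 2))
      (a / (2 * (2 * expR (b ^+ 2) + n%:R * a ^+ 2)))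
      (2 * expR (b ^+ 2) * a / (2 * expR (b ^+ 2) + n.+1%:R * a ^+ 2))
      (n%:R * a ^+ 2 * b / (2 * expR (b ^+ 2) + n%:R * a ^+ 2)).

Definition Ct (n : nat) : 'M[R]_2 :=
  mx2 (n%:R / 2 * ((n.+1%:R * a ^+ 2 + 2 * expR (b ^+ 2))
                   / (2 * expR (b ^+ 2) + n%:R * a ^+ 2)))
      0
      (- (2 * n%:R * a * b * expR (b ^+ 2)
          / (2 * expR (b ^+ 2) + n%:R * a ^+ 2)))
      (n%:R / 2).

End HermiteExample.

(* Main.v *)
Require Import Defs.
From mathcomp Require Import all_boot all_order all_algebra.
From mathcomp Require Import all_classical all_reals all_analysis.
From mathcomp Require Import measurable_realfun ring lra.
Set Implicit Arguments.
Unset Strict Implicit.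
Unset Printing Implicit Defensive.
Import Order.TTheory GRing.Theory Num.Theory.
Import numFieldNormedType.Exports.
Local Open Scope ring_scope.

(* The recurrence follows entrywise from [H_(n+1) = x H_n - n/2 H_(n-1)].  For
   the orthogonality, completing the square in [e^(-x^2) e^(2bx)] turns each
   entry of [Q_m W Q_n^*] into a combination of Hermite products
   [H_j(x-b) H_k(x-b) e^(-(x-b)^2)] and [H_j(x) H_k(x) e^(-x^2)].  The integrals
   of the two kinds are the same numbers; the diagonal entries vanish for
   [m <> n] by Hermite orthogonality, the off-diagonal ones always, because
   [||H_(n+1)||^2 = (n+1)/2 ||H_n||^2]. *)

(** * Monic Hermite polynomials and Rodrigues' formula *)

Section HermitePoly.
Variable R : realType.

(** This step through the derivative is the one Rodrigues' formula produces; the three-term form is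
    derived in [hermpS]. *)
Fixpoint hermp (n : nat) : {poly R} :=
  if n is m.+1 then 'X * hermp m - 2^-1 *: (hermp m)^`() else 1.

(** Differentiating the recursion gives H_(n+1) plus, by induction, (n+1) (X H_n - H_n' / 2) = (n+1)
    H_(n+1). *)
Lemma deriv_hermpS n : (hermp n.+1)^`() = n.+1%:R *: hermp n.
Proof.
elim: n => [|n IHn].
  by rewrite /= derivC scaler0 subr0 mulr1 derivX scale1r.
rewrite [hermp n.+2]/= derivB derivM derivX mul1r -/(hermp n.+1) derivZ IHn.
rewrite derivZ -[n.+2%:R]natr1 scalerDl scale1r [RHS]addrC -addrA; congr (_ + _).
by rewrite /= scalerBr -scalerAr !scalerA [2^-1 * _]mulrC.
Qed.

Lemma deriv_hermp n : (hermp n)^`() = n%:R *: hermp n.-1.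
Proof. by case: n => [|n]; [rewrite scale0r derivC | exact: deriv_hermpS]. Qed.

Lemma hermpS n : hermp n.+1 = 'X * hermp n - (n%:R / 2) *: hermp n.-1.
Proof. by rewrite /= deriv_hermp scalerA [_ / 2]mulrC. Qed.

Lemma hermp_size_monic n : size (hermp n) = n.+1 /\ hermp n \is monic.
Proof.
elim: n => [|n [sn mn]]; first by rewrite size_poly1 monic1.
have sX : size ('X * hermp n) = n.+2.
  by rewrite mulrC size_mulX ?sn// -size_poly_eq0 sn.
have lt_s : (size (- (2^-1 *: (hermp n)^`()))%R < size ('X * hermp n)%R)%N.
  rewrite size_polyN sX ltnS; apply: leq_trans (size_scale_leq _ _) _.
  by apply: leq_trans (size_poly _ _) _; rewrite sn.
rewrite /= size_polyDl// sX; split=> //.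
by rewrite monicE lead_coefDl// mulrC lead_coefMX -monicE.
Qed.

(** Differentiating p e^(-t^2) replaces p by p' - 2 X p, which sends (-2)^n H_n to (-2)^(n+1)
    H_(n+1). *)
Lemma hermiteE n x : hermite n x = (hermp n).[x].
Proof.
pose g := fun t : R => expR (- t ^+ 2).
have dg (p : {poly R}) (t : R) :
    is_derive t 1 (fun u : R => p.[u] * g u) ((p^`() - 2 *: ('X * p)).[t] * g t).
  apply: trigger_derive.
  by rewrite /g !hornerE /= /GRing.scale/=; ring.
have -> : hermite n x = (-1) ^+ n / 2 ^+ n * derive1n n g x * expR (x ^+ 2) by [].
have -> : derive1n n g = fun t : R => ((- 2) ^+ n *: hermp n).[t] * g t.
  elim: n => [|n IHn].
    by apply/funext=> t; rewrite derive1n0 expr0 scale1r hornerC mul1r.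
  rewrite derive1nS IHn; apply/funext=> t; rewrite derive1E.
  have Hd := dg ((- 2) ^+ n *: hermp n) t; rewrite derive_val; congr (_.[_] * _).
  rewrite derivZ -scalerAr exprS [hermp _]/= scalerBr !scalerA -!scaleNr addrC.
  congr (_ *: _ + _ *: _).
  by rewrite /GRing.scale/=; field.
rewrite /g hornerZ (exprNn 2 n).
rewrite (_ : _ * _ = ((-1) ^+ n * (-1) ^+ n) * (2 ^- n * 2 ^+ n)
  * (hermp n).[x] * (expR (- x ^+ 2) * expR (x ^+ 2))); last by ring.
rewrite -expRD addNr expR0 -[(-1) ^+ n * _]exprMn mulrNN !mulr1 expr1n.
by rewrite mulVf ?expf_neq0 ?pnatr_eq0// !mul1r.
Qed.

Lemma hermite0 x : hermite 0 x = 1 :> R.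
Proof. by rewrite hermiteE hornerC. Qed.

Lemma hermiteS n x :
  hermite n.+1 x = x * hermite n x - n%:R / 2 * hermite n.-1 x :> R.
Proof. by rewrite !hermiteE hermpS !hornerE. Qed.

End HermitePoly.

(** * Algebra of two-by-two matrices *)

Section Mx2.
Variable R : comNzRingType.
Implicit Types p q r s : R.

Lemma ord2_cases (P : 'I_2 -> Prop) : P ord0 -> P ord_max -> forall i, P i.
Proof.
move=> P0 P1 i; case: (ltngtP i 1) => [||] Hi.
- by rewrite (_ : i = ord0)//; apply/val_inj; case: i Hi => -[].
- by have := ltn_ord i; rewrite ltnNge Hi.
- by rewrite (_ : i = ord_max)//; apply/val_inj.
Qed.

Lemma mx2P (A B : 'M[R]_2) :
  [/\ A ord0 ord0 = B ord0 ord0, A ord0 ord_max = B ord0 ord_max,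
      A ord_max ord0 = B ord_max ord0 & A ord_max ord_max = B ord_max ord_max] ->
  A = B.
Proof. by case=> *; apply/matrixP; do 2 elim/ord2_cases. Qed.

Lemma mx2M p q r s p' q' r' s' :
  mx2 p q r s *m mx2 p' q' r' s' =
  mx2 (p * p' + q * r') (p * q' + q * s') (r * p' + s * r') (r * q' + s * s').
Proof. by apply: mx2P; split; rewrite !mxE !big_ord_recl big_ord0 !mxE addr0. Qed.

Lemma mx2D p q r s p' q' r' s' :
  mx2 p q r s + mx2 p' q' r' s' = mx2 (p + p') (q + q') (r + r') (s + s').
Proof. by apply: mx2P; split; rewrite !mxE. Qed.

Lemma mx2Z c p q r s : c *: mx2 p q r s = mx2 (c * p) (c * q) (c * r) (c * s).
Proof. by apply: mx2P; split; rewrite !mxE. Qed.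

Lemma mx2T p q r s : (mx2 p q r s)^T = mx2 p r q s.
Proof. by apply: mx2P; split; rewrite !mxE. Qed.

End Mx2.

Lemma mx2_upper_unit (F : fieldType) (p q s : F) :
  p != 0 -> s != 0 -> mx2 p q 0 s \in unitmx.
Proof.
move=> p0 s0.
have /mulmx1_unit[] // : mx2 p q 0 s *m mx2 p^-1 (- q / (p * s)) 0 s^-1 = 1%:M.
rewrite mx2M; apply: mx2P; split; rewrite !mxE/=;
  by field; rewrite ?p0 ?s0.
Qed.

(** * The three-term recurrence *)

Section Recurrence.
Variables (R : realType) (a b : R).

Let D_neq0 (n : nat) : 2 * expR (b ^+ 2) + n%:R * a ^+ 2 != 0.
Proof.
by rewrite gt_eqF// ltr_pwDl ?mulr_gt0 ?expR_gt0// mulr_ge0 ?sqr_ge0.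
Qed.

Lemma Q_recurrence n (x : R) :
  x *: Q a b n x =
    At a b n *m Q a b n.+1 x + Bt a b n *m Q a b n x
    + Ct a b n *m Qprev a b n x.
Proof.
have D0 := D_neq0 n; have D1 := D_neq0 n.+1.
have E0 : expR (b ^+ 2) != 0 by rewrite gt_eqF// expR_gt0.
case: n => [|n] in D0 D1 *.
  rewrite mulmx0 addr0 /Q /At /Bt !mx2M mx2D mx2Z /=.
  rewrite !hermiteS !hermite0 /=.
  rewrite mul1r in D1.
  by congr mx2; field; rewrite E0.
rewrite /Qprev /Q /At /Bt /Ct !mx2M !mx2D mx2Z /=.
(* Indices are lowered until only [hermite n] and [hermite n.-1] at x and x - b remain; what is left
   is a rational identity. *)
rewrite (hermiteS n.+2 x) (hermiteS n.+1 x) (hermiteS n.+1 (x - b)) /=.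
rewrite (hermiteS n (x - b)) (hermiteS n x) /=.
rewrite -[n.+1]add1n natrD in D0; rewrite -[n.+2]add2n natrD in D1.
by congr mx2; field; rewrite D0 D1.
Qed.

End Recurrence.

(** * Degree and leading coefficient of [Q] *)

Section LeadingCoefficient.
Variable R : realType.

(** The lower left entry has degree below n, so the coefficient of x^n is upper triangular, and
    invertible by its nonzero diagonal. *)
Lemma mx2_poly_nonsing_lead n (p q r s : {poly R}) :
    (size p <= n.+1)%N -> (size q <= n.+1)%N ->
    (size r <= n)%N -> (size s <= n.+1)%N -> p`_n != 0 -> s`_n != 0 ->
  mxpoly_nonsing_lead n (fun x => mx2 p.[x] q.[x] r.[x] s.[x]).
Proof.
move=> sp sq sr ss p0 s0.
exists (fun k => mx2 p`_k q`_k r`_k s`_k); split=> [|x].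
  by rewrite /= [r`_n]nth_default// mx2_upper_unit.
have sr' := leqW sr.
apply: mx2P; split; rewrite summxE mxE/= (@horner_coef_wide _ n.+1)//;
  by apply: eq_bigr => k _; rewrite !mxE/= mulrC.
Qed.

Lemma hermp_comp_size_monic (c : R) n :
  size (hermp R n \Po ('X - c%:P)) = n.+1 /\ hermp R n \Po ('X - c%:P) \is monic.
Proof.
have [sn mn] := hermp_size_monic R n.
rewrite size_comp_poly2 ?size_XsubC// monicE lead_coef_comp ?size_XsubC//.
by rewrite lead_coefXsubC expr1n mulr1 -monicE.
Qed.

Lemma Q_nonsing_lead (a b : R) n : mxpoly_nonsing_lead n (Q a b n).
Proof.
pose h k := hermp R k \Po ('X - b%:P).
have sh k : size (h k) = k.+1 by have [] := hermp_comp_size_monic b k.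
have hk k : (h k)`_k = 1.
  by have [_ /monicP] := hermp_comp_size_monic b k; rewrite lead_coefE sh.
have sg k : size (hermp R k) = k.+1 by have [] := hermp_size_monic R k.
have gk k : (hermp R k)`_k = 1.
  by have [_ /monicP] := hermp_size_monic R k; rewrite lead_coefE sg.
have -> : Q a b n = fun x => mx2 (h n).[x]
    (a *: (hermp R n.+1 - 'X * h n)).[x]
    ((- (a * n%:R)) *: h n.-1).[x]
    ((2 * expR (b ^+ 2)) *: hermp R n + (a ^+ 2 * n%:R) *: ('X * h n.-1)).[x].
  apply/funext=> x; rewrite /Q !hermiteE.
  by congr mx2; rewrite !(hornerE, horner_comp)/=; ring.
apply: mx2_poly_nonsing_lead.
- by rewrite sh.
(* Both terms are monic of degree n + 1, so their difference has degree at most n. *)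
- apply: leq_trans (size_scale_leq _ _) _; apply/leq_sizeP => j.
  rewrite leq_eqVlt => /predU1P[<-|lt_nj]; rewrite coefB coefXM.
    by rewrite gk hk subrr.
  case: j lt_nj => // j lt_nj.
  by rewrite [X in _ - X]nth_default ?sh// subr0 nth_default// sg.
- case: n => [|n]; first by rewrite mulr0 oppr0 scale0r size_poly0.
  by apply: leq_trans (size_scale_leq _ _) _; rewrite sh.
- apply: leq_trans (size_polyD _ _) _; rewrite geq_max.
  rewrite (leq_trans (size_scale_leq _ _)) ?sg//=.
  (* For n = 0 the truncated [h n.-1] times X has degree 1, but its factor n is zero. *)
  case: n => [|n]; first by rewrite mulr0 scale0r size_poly0.
  apply: leq_trans (size_scale_leq _ _) _; rewrite mulrC size_mulX ?sh//.
  by rewrite -size_poly_eq0 sh.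
- by rewrite hk oner_neq0.
- rewrite coefD !coefZ gk mulr1 gt_eqF// ltr_pwDl ?mulr_gt0 ?expR_gt0//.
  apply: mulr_ge0; first by rewrite mulr_ge0 ?sqr_ge0.
  by rewrite coefXM; case: n => //= n; rewrite hk.
Qed.

End LeadingCoefficient.

(** * Integrals of polynomials against shifted Gaussians *)

Section GaussianIntegrals.
Variable R : realType.
Local Open Scope classical_set_scope.
Local Open Scope ring_scope.
Implicit Types (p q : {poly R}) (c t x : R).
Local Notation mu := (@lebesgue_measure R).

(** Here |t|^i <= 1 + t^(2i), and (t^2/2)^i / i! is a term of the series of e^(t^2/2). *)
Lemma normr_exp_le_gauss i t :
  `|t| ^+ i <= (1 + 2 ^+ i * i`!%:R) * expR (t ^+ 2 / 2).
Proof.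
have e1 : 1 <= expR (t ^+ 2 / 2) by rewrite -expR0 ler_expR divr_ge0 ?sqr_ge0.
have le1 : `|t| ^+ i <= 1 + (t ^+ 2) ^+ i.
  rewrite -[t ^+ 2]real_normK ?num_real// -exprM mulnC exprM.
  by have := sqr_ge0 (`|t| ^+ i - 2^-1); nra.
apply: (le_trans le1); rewrite mulrDl mul1r lerD//.
case: i {le1} => [|i]; first by rewrite !expr0 !mul1r.
have x0 : 0 <= t ^+ 2 / 2 by rewrite divr_ge0 ?sqr_ge0.
have : (t ^+ 2 / 2) ^+ i.+1 / i.+1`!%:R <= expR (t ^+ 2 / 2).
  by apply: le_trans (expR_ge1Dxn i x0); rewrite lerDr.
rewrite ler_pdivrMr ?ltr0n ?fact_gt0// expr_div_n ler_pdivrMr ?exprn_gt0//.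
by rewrite -mulrA [expR _ * _]mulrC [i.+1`!%:R * _]mulrC.
Qed.

Lemma normr_poly_le_gauss p :
  exists2 K, 0 <= K & forall t, `|p.[t]| <= K * expR (t ^+ 2 / 2).
Proof.
exists (\sum_(i < size p) `|p`_i| * (1 + 2 ^+ i * i`!%:R)).
  by apply: sumr_ge0 => i _; rewrite mulr_ge0// addr_ge0// mulr_ge0// exprn_ge0.
move=> t; rewrite horner_coef mulr_suml; apply: le_trans (ler_norm_sum _ _ _) _.
apply: ler_sum => i _; rewrite normrM normrX -mulrA ler_wpM2l//.
exact: normr_exp_le_gauss.
Qed.

(** The polynomial is taken in x - c, so that derivatives stay in the family and integrals do not
    depend on c. *)
Definition pgauss p c x : R := p.[x - c] * expR (- (x - c) ^+ 2).

(** Half of the exponent absorbs the polynomial; the other half is, up to a constant, the normal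
    density of variance 1, an integrable bound. *)
Lemma pgauss_le p : exists2 K, 0 <= K &
  forall c x, `|pgauss p c x| <= K * expR (- (x - c) ^+ 2 / 2).
Proof.
have [K K0 leK] := normr_poly_le_gauss p; exists K => // c x.
rewrite normrM [`|expR _|]ger0_norm ?expR_ge0//.
apply: le_trans (ler_wpM2r (expR_ge0 _) (leK _)) _.
by rewrite -mulrA -expRD ler_wpM2l// ler_expR; lra.
Qed.

Lemma is_derive_pgauss p c x :
  is_derive x 1 (pgauss p c) (pgauss (p^`() - 2 *: ('X * p)) c x).
Proof.
have -> : pgauss p c =
  (fun y => (p \Po ('X - c%:P)).[y] * expR (- (y - c) ^+ 2)).
  by apply/funext=> y; rewrite /pgauss horner_comp !hornerE.
apply: trigger_derive.
rewrite /pgauss deriv_comp !(hornerE, horner_comp) derivB derivX derivC.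
rewrite /GRing.scale !hornerE/=.
by ring.
Qed.

Lemma continuous_pgauss p c : continuous (pgauss p c).
Proof.
move=> x; apply/differentiable_continuous/derivable1_diffP.
by have [] := is_derive_pgauss p c x.
Qed.

Lemma integrable_pgauss p c : mu.-integrable setT (EFin \o pgauss p c).
Proof.
have [K K0 leK] := pgauss_le p.
have ipdf := integrable_normal_pdf c (1 : R).
apply: le_integrable (integrableZl _ (K / normal_peak 1) ipdf) => //.
  apply/measurable_EFinP; apply: continuous_measurable_fun.
  exact: continuous_pgauss.
move=> x _; rewrite -EFinM !abse_EFin lee_fin.
have pk : normal_peak (1 : R) > 0 by rewrite normal_peak_gt0 ?oner_eq0.
rewrite normal_pdfE ?oner_eq0// /normal_fun mulrA divfK ?gt_eqF//.
rewrite expr1n mulr2n.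
by apply: le_trans (leK c x) _; rewrite ler_norm.
Qed.

(** Multiplying by x turns p into (X + c) p, whose [pgauss] is bounded, whence a decay in 1/(n+1).
    The sequence [u] serves for both n + 1 and -(n+1). *)
Lemma pgauss_cvg0 p c (u : nat -> R) : (forall n, `|u n| = n.+1%:R) ->
  pgauss p c (u n) @[n --> \oo] --> 0.
Proof.
move=> un; have [K K0 leK] := pgauss_le (('X + c%:P) * p).
have le_pu n : `|pgauss p c (u n)| <= K * n.+1%:R^-1.
  rewrite ler_pdivlMr// -un -normrM.
  have -> : pgauss p c (u n) * u n = pgauss (('X + c%:P) * p) c (u n).
    by rewrite /pgauss !hornerE; ring.
  apply: le_trans (leK _ _) _; rewrite -[leRHS]mulr1 ler_wpM2l//.
  by rewrite -expR0 ler_expR mulNr oppr_le0 divr_ge0 ?sqr_ge0.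
have K_cvg0 : K * n.+1%:R^-1 @[n --> \oo] --> 0.
  rewrite -[X in _ --> X](mulr0 K).
  exact: cvgM (cvg_cst K) cvg_harmonic.
apply: (@squeeze_cvgr _ _ _ _ (fun n => - (K * n.+1%:R^-1))
  (fun n => K * n.+1%:R^-1)) => //.
- by apply: nearW => n; rewrite -ler_norml.
- by rewrite -oppr0; exact: cvgN.
Qed.

(** The integral over [-(n+1), n+1] is an increment of [F], which tends to 0; dominated convergence
    with bound |f| identifies the limit. *)
Lemma Rintegral_deriv_eq0 (f F : R -> R) :
    continuous f -> mu.-integrable setT (EFin \o f) ->
    (forall x, is_derive x 1 F (f x)) ->
    F n.+1%:R @[n --> \oo] --> 0 ->
    F (- n.+1%:R) @[n --> \oo] --> 0 ->
  Rintegral mu setT f = 0.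
Proof.
move=> cf intf dF Fy FNy.
have cF : continuous F.
  move=> x; apply/differentiable_continuous/derivable1_diffP.
  by have [] := dF x.
have mf : measurable_fun setT f by exact: continuous_measurable_fun.
pose I n := (`[- n.+1%:R, n.+1%:R]%classic : set R).
have mI n : measurable (I n) by exact: measurable_itv.
have mfI n : measurable_fun setT (f \_ (I n)).
  have [mfI _] := measurable_restrictT f (mI n).
  by apply: mfI; exact: measurable_funTS.
pose f_ n x := ((f \_ (I n)) x)%:E.
have FTC n : (\int[mu]_x f_ n x = (F n.+1%:R - F (- n.+1%:R))%:E)%E.
  rewrite EFinB -(@continuous_FTC2 _ f F)//.
  - by rewrite [RHS]integral_mkcond; apply: eq_integral => x _; rewrite restrict_EFin.
  - by rewrite -subr_gt0 opprK addr_gt0.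
  - exact: continuous_subspaceT.
  - split=> [x _||]; first by have [] := dF x.
    + by apply: cvg_at_right_filter; exact: cF.
    + by apply: cvg_at_left_filter; exact: cF.
  - by move=> x _; rewrite derive1E; have Hd := dF x; exact: derive_val.
have [_ _ dct] : [/\ mu.-integrable setT (EFin \o f),
  ([sequence \int[mu]_x `|f_ n x - (f x)%:E|]_n @ \oo --> 0)%E &
  ([sequence \int[mu]_x f_ n x]_n @ \oo --> \int[mu]_x (f x)%:E)%E].
  apply: (@dominated_convergence _ _ _ mu setT measurableT f_ _ (abse \o (EFin \o f))).
  - by move=> n; apply/measurable_EFinP; exact: mfI.
  - exact: (measurable_int mu intf).
  - apply: aeW => x _; apply: cvg_near_cst; near=> n.
    rewrite /f_ patchE mem_set//= /I /= in_itv/= -ler_norml.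
    apply: (@le_trans _ _ n%:R); last by rewrite ler_nat.
    by near: n; exact: nbhs_infty_ger.
  - exact: integrable_abse.
  - apply: aeW => x n _; rewrite /f_ /= lee_fin patchE.
    by case: ifP => // _; rewrite normr0.
have F0 : ([sequence \int[mu]_x f_ n x]_n @ \oo --> 0%:E)%E.
  rewrite (_ : (fun n => _) = EFin \o (fun n => F n.+1%:R - F (- n.+1%:R))).
    by apply: cvg_EFin; [exact: nearW | rewrite -(subr0 0); exact: cvgB].
  by apply/funext => n /=; rewrite FTC.
by rewrite /Rintegral (cvg_unique _ dct F0).
Unshelve. all: by end_near.
Qed.

Lemma Rintegral_pgauss_deriv p c :
  Rintegral mu setT (pgauss (p^`() - 2 *: ('X * p)) c) = 0.
Proof.
apply: (@Rintegral_deriv_eq0 _ (pgauss p c)).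
- exact: continuous_pgauss.
- exact: integrable_pgauss.
- by move=> x; exact: is_derive_pgauss.
- by apply: pgauss_cvg0 => n; rewrite normr_nat.
- by apply: pgauss_cvg0 => n; rewrite normrN normr_nat.
Qed.

Lemma pgauss_lin p q (k l : R) c x :
  pgauss (k *: p + l *: q) c x = k * pgauss p c x + l * pgauss q c x.
Proof. by rewrite /pgauss !hornerE /=; ring. Qed.

Lemma Rintegral_pgaussZ (k : R) p c :
  Rintegral mu setT (pgauss (k *: p) c) = k * Rintegral mu setT (pgauss p c).
Proof.
rewrite -RintegralZl//; last exact: integrable_pgauss.
by apply: eq_Rintegral => x _; rewrite /pgauss hornerZ mulrA.
Qed.

(** Two centres are allowed because [Q] mixes Hermite polynomials at x - b and at x. *)
Lemma Rintegral_pgauss_lin p q (k l : R) c c' :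
  Rintegral mu setT (fun x => k * pgauss p c x + l * pgauss q c' x) =
  k * Rintegral mu setT (pgauss p c) + l * Rintegral mu setT (pgauss q c').
Proof.
rewrite RintegralD//; last 2 first.
- exact: (integrableZl measurableT k (integrable_pgauss p c)).
- exact: (integrableZl measurableT l (integrable_pgauss q c')).
by rewrite !RintegralZl//; exact: integrable_pgauss.
Qed.

(* Integration by parts, in the form [H_(n+1) w = - (H_n w)' / 2]. *)
Lemma Rintegral_pgauss_hermpS n q c :
  Rintegral mu setT (pgauss (hermp R n.+1 * q) c) =
  2^-1 * Rintegral mu setT (pgauss (hermp R n * q^`()) c).
Proof.
have := Rintegral_pgauss_deriv (hermp R n * q) c.
rewrite (_ : pgauss _ c = fun x =>
  - 2 * pgauss (hermp R n.+1 * q) c x + 1 * pgauss (hermp R n * q^`()) c x).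
  by rewrite Rintegral_pgauss_lin; lra.
apply/funext=> x; rewrite -pgauss_lin /=; congr pgauss.
have half : 2%:P * (2^-1)%:P = 1 :> {poly R} by rewrite -polyCM divff.
rewrite derivM -!mul_polyC polyCN; move: (_^`()) half => h' half.
transitivity (2%:P * (2^-1)%:P * h' * q + hermp R n * q^`()
  - 2%:P * ('X * (hermp R n * q))); first by rewrite half mul1r.
by rewrite polyC1; ring.
Qed.

(** The normal density of variance 1/2 is e^(-(x-c)^2) / sqrt(pi), of total mass 1. *)
Lemma Rintegral_pgauss1 c : Rintegral mu setT (pgauss 1 c) = Num.sqrt pi.
Proof.
have s2 : Num.sqrt 2^-1 ^+ 2 = 2^-1 :> R by rewrite sqr_sqrtr.
have s0 : Num.sqrt 2^-1 != 0 :> R by rewrite gt_eqF// sqrtr_gt0.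
have pk : normal_peak (Num.sqrt 2^-1) = (Num.sqrt pi)^-1 :> R.
  by rewrite /normal_peak s2 -mulr_natr mulrAC mulVf ?mul1r.
have sp : Num.sqrt pi != 0 :> R by rewrite gt_eqF// sqrtr_gt0 pi_gt0.
have : Rintegral mu setT (normal_pdf c (Num.sqrt 2^-1)) = 1.
  by rewrite /Rintegral integral_normal_pdf.
rewrite (_ : normal_pdf _ _ = fun x => (Num.sqrt pi)^-1 * pgauss 1 c x).
  rewrite RintegralZl//; last exact: integrable_pgauss.
  by move=> /(congr1 ( *%R (Num.sqrt pi))); rewrite mulrA divff// mul1r mulr1.
apply/funext=> x; rewrite normal_pdfE// pk /normal_fun s2 mulr2n /pgauss hornerC.
by congr (_ * _); rewrite mul1r; congr expR; field.
Qed.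

Lemma Rintegral_pgauss_hermp0 n c :
  Rintegral mu setT (pgauss (hermp R n.+1) c) = 0.
Proof.
rewrite -[hermp R n.+1]mulr1 Rintegral_pgauss_hermpS derivC mulr0.
have := Rintegral_pgauss_deriv 0 c.
by rewrite deriv0 mulr0 scaler0 subr0 => ->; rewrite mulr0.
Qed.

(** Each integration by parts lowers both indices, until one of them is 0, and lowering n + 1 to n
    contributes (n+1)/2. The value is free of c, so integrals centred at b and at 0 can cancel. *)
Lemma Rintegral_pgauss_hermp m n c :
  Rintegral mu setT (pgauss (hermp R m * hermp R n) c) =
  (m == n)%:R * (n`!%:R / 2 ^+ n * Num.sqrt pi).
Proof.
elim: m n => [|m IHm] [|n].
- by rewrite mulr1 Rintegral_pgauss1 eqxx fact0 expr0 invr1 !mul1r.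
- by rewrite mul1r Rintegral_pgauss_hermp0 mul0r.
- by rewrite mulr1 Rintegral_pgauss_hermp0 mul0r.
- rewrite Rintegral_pgauss_hermpS deriv_hermpS -scalerAr.
  rewrite Rintegral_pgaussZ IHm eqSS factS natrM exprS.
  by field; rewrite expf_neq0 ?pnatr_eq0.
Qed.

End GaussianIntegrals.

(** * Orthogonality with respect to [Wt] *)

Section Orthogonality.
Variables (R : realType) (a b : R).
Local Notation mu := (@lebesgue_measure R).

(* [Wt = e^(-x^2) T T^*] with [T = [[e^(bx), ax], [0, 1]]], and the products by
   [x] cancel in [Q T = [[h_n e^(bx), a g_(n+1)], [- a n h_(n-1) e^(bx),
   2 e^(b^2) g_n]]], where [h] and [g] are Hermite polynomials at [x - b] and
   at [x].  The pair lists the polynomials in [x - b] and in [x] that result. *)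
Definition QWQ_poly (m n : nat) (i j : 'I_2) : {poly R} * {poly R} :=
  let h := hermp R in
  if i == ord0 then
    if j == ord0 then (h m * h n, a ^+ 2 *: (h m.+1 * h n.+1))
    else (- (a * n%:R) *: (h m * h n.-1),
          (2 * expR (b ^+ 2) * a) *: (h m.+1 * h n))
  else
    if j == ord0 then (- (a * m%:R) *: (h m.-1 * h n),
          (2 * expR (b ^+ 2) * a) *: (h m * h n.+1))
    else ((a ^+ 2 * m%:R * n%:R) *: (h m.-1 * h n.-1),
          (2 * expR (b ^+ 2)) ^+ 2 *: (h m * h n)).

(** The factor e^(b^2) comes from e^(-x^2+2bx) = e^(b^2) e^(-(x-b)^2); the written [1] gives the
    shape of [Rintegral_pgauss_lin]. *)
Lemma ip_integrand_QWQ m n i j x :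
  ip_integrand (Wt a b) (Q a b m) (Q a b n) i j x =
  expR (b ^+ 2) * pgauss (QWQ_poly m n i j).1 b x
  + 1 * pgauss (QWQ_poly m n i j).2 0 x.
Proof.
have E0 : expR (b ^+ 2) != 0 by rewrite gt_eqF ?expR_gt0.
have shift : expR (- (x - b) ^+ 2) =
    expR (- x ^+ 2) * expR (2 * b * x) / expR (b ^+ 2).
  by rewrite -expRN -!expRD; congr expR; ring.
rewrite /ip_integrand /Wt /Q -scalemxAr -scalemxAl !mx2M mx2T mx2M mx2Z.
rewrite !hermiteE mxE /QWQ_poly /pgauss.
by case: ifP => _; case: ifP => _; rewrite !(hornerZ, hornerM) subr0 shift;
  field.
Qed.

Lemma integrable_ip_integrand m n i j : mu.-integrable setT
  (EFin \o ip_integrand (Wt a b) (Q a b m) (Q a b n) i j).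
Proof.
rewrite (funext (ip_integrand_QWQ m n i j)).
have ip k p c : mu.-integrable setT (EFin \o (fun x => k * pgauss p c x)).
  exact: (integrableZl measurableT k (integrable_pgauss p c)).
exact: (integrableD measurableT (ip _ _ _) (ip _ _ _)).
Qed.

Lemma mxip_Q m n : m <> n -> mxip (Wt a b) (Q a b m) (Q a b n) = 0.
Proof.
move=> /eqP/negPf mn; apply/matrixP => i j; rewrite !mxE.
rewrite (funext (ip_integrand_QWQ m n i j)) Rintegral_pgauss_lin /QWQ_poly.
case: ifP => _; case: ifP => _; cbn [fst snd];
  rewrite ?Rintegral_pgaussZ !Rintegral_pgauss_hermp.
- by rewrite eqSS mn !mul0r !mulr0 addr0.
(* After the shift of n both terms carry the same Kronecker delta, and (n+1) ||H_n||^2 = 2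
   ||H_(n+1)||^2 cancels them. *)
- case: n mn => [|n] mn; first by rewrite !mulr0 mul0r oppr0 mul0r !mulr0 addr0.
  rewrite eqSS factS natrM (exprS 2 n) [n.+1.-1]/=.
  by field; rewrite expf_neq0 ?pnatr_eq0.
- case: m mn => [|m] mn; first by rewrite !mulr0 mul0r oppr0 mul0r !mulr0 addr0.
  (* The norms are expressed in n and the coefficient in m, so m = n is substituted before
     cancelling. *)
  rewrite eqSS /=; case: eqP => [->|_]; last by rewrite !mul0r !mulr0 addr0.
  rewrite factS natrM (exprS 2 n).
  by field; rewrite expf_neq0 ?pnatr_eq0.
- rewrite mn mul0r !mulr0 addr0.
  (* Truncated predecessors also agree for the indices 0 and 1, but then the factor m n is zero. *)
  case: m n mn => [|m] [|n] mn; rewrite ?(mulr0, mul0r)//.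
  by rewrite /= -eqSS mn !(mulr0, mul0r).
Qed.

End Orthogonality.

Theorem proposition5p2 (R : realType) (a b : R) (ha : a != 0) (hb : b != 0) :
  mx_orthogonal (Wt a b) (Q a b) /\
  forall (n : nat) (x : R),
    x *: Q a b n x =
      At a b n *m Q a b n.+1 x + Bt a b n *m Q a b n x
      + Ct a b n *m Qprev a b n x.
Proof.
split; last by move=> n x; exact: Q_recurrence.
split; [exact: Q_nonsing_lead | exact: integrable_ip_integrand | exact: mxip_Q].
Qed.
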